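(* Let $u,v:(0,1)\to(0,\infty)$ be continuous functions such that, for some constant $M$, $|u(r)-v(r)|<M$ for all $r\in(0,1)$. Suppose also that $u(r)<\mu(r)<v(r)$ for all $r\in(0,1)$. Then, for every $r\in(0,1)$, $$\lim_{p\to-\infty}2^p\,u(L(r,p))=\lim_{p\to-\infty}2^p\,v(L(r,p))=\mu(r),$$ where $p$ runs through the integers.
   Context: Landen sequences: for $r\in(0,1)$ put $L(r,0)=r$ and, for $p=0,1,2,\ldots$, define recursively $$L(r,p+1)=\frac{2\sqrt{L(r,p)}}{1+L(r,p)},\qquad L(r,-p-1)=\left(\frac{L(r,-p)}{1+\sqrt{1-L(r,-p)^2}}\right)^2 .$$ This defines $L(r,p)\in(0,1)$ for all $r\in(0,1)$ and $p\in\mathbb{Z}$. The complete elliptic integral is $\mathcal{K}(r)=\int_0^1\frac{dx}{\sqrt{(1-x^2)(1-r^2x^2)}}$ for $r\in(0,1)$. With $r'=\sqrt{1-r^2}$, the decreasing homeomorphism $\mu:(0,1)\to(0,\infty)$ is defined by $\mu(r)=\frac{\pi}{2}\frac{\mathcal{K}(r')}{\mathcal{K}(r)}$. *)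

(* Defs.v *)
From Stdlib Require Import Reals ZArith Lia Lra.
From Coquelicot Require Import Coquelicot.
Open Scope R_scope.

Definition landen_up (x : R) : R := 2 * sqrt x / (1 + x).

Definition landen_down (x : R) : R := (x / (1 + sqrt (1 - x ^ 2))) ^ 2.

Definition L (r : R) (p : Z) : R :=
  match p with
  | Z0 => r
  | Zpos n => Nat.iter (Pos.to_nat n) landen_up r
  | Zneg n => Nat.iter (Pos.to_nat n) landen_down r
  end.

Lemma L_0 (r : R) : L r 0 = r.
Proof. reflexivity. Qed.

Lemma L_succ (r : R) (p : Z) : (0 <= p)%Z ->
  L r (p + 1) = 2 * sqrt (L r p) / (1 + L r p).
Proof.
intros hp; destruct p as [|n|n]; [reflexivity| |lia].
change (Z.pos n + 1)%Z with (Z.pos (n + 1)).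
unfold L; rewrite Pos.add_1_r, Pos2Nat.inj_succ; reflexivity.
Qed.

Lemma L_pred (r : R) (p : Z) : (0 <= p)%Z ->
  L r (- p - 1) = (L r (- p) / (1 + sqrt (1 - L r (- p) ^ 2))) ^ 2.
Proof.
intros hp; destruct p as [|n|n]; [reflexivity| |lia].
change (- Z.pos n - 1)%Z with (Z.neg (n + 1)).
change (- Z.pos n)%Z with (Z.neg n).
unfold L; rewrite Pos.add_1_r, Pos2Nat.inj_succ; reflexivity.
Qed.

(* The integrand is singular at 1, so the integral is improper there. *)
Definition K (r : R) : R :=
  RInt_gen (fun x => / sqrt ((1 - x ^ 2) * (1 - r ^ 2 * x ^ 2)))
    (at_point 0) (at_left 1).

Definition mu (r : R) : R := PI / 2 * (K (sqrt (1 - r ^ 2)) / K r).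

Definition open01 (r : R) : Prop := 0 < r < 1.

(* The filter of p -> -oo through the integers. *)
Definition Z_minus_infty : (Z -> Prop) -> Prop :=
  fun P => exists N : Z, forall p : Z, (p <= N)%Z -> P p.

Global Instance Z_minus_infty_proper : ProperFilter Z_minus_infty.
Proof.
split.
- intros P [N hN]; exists N; apply hN; lia.
- split.
  + exists 0%Z; auto.
  + intros P Q [N hN] [M hM]; exists (Z.min N M); intros p hp.
    split; [apply hN | apply hM]; lia.
  + intros P Q hPQ [N hN]; exists N; auto.
Qed.

(* Main.v *)
Require Import Defs.
From Stdlib Require Import Reals ZArith Lia Lra.
From Coquelicot Require Import Coquelicot.
Open Scope R_scope.

(** The descending Landen map doubles [mu]: [mu (landen_down x) = 2 * mu x].
    Hence [2 ^ p * mu (L r p) = mu r] for every [p <= 0], and a function [w]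
    within bounded distance [M] of [mu] satisfies
    [|2 ^ p * w (L r p) - mu r| <= 2 ^ p * M], which tends to [0].  Both [u] and
    [v] are within [M] of [mu], since [mu] lies between them.

    The doubling comes from one identity, Landen's transformation
    [K (landen_up r) = (1 + r) * K r] ([K_landen_up]).  Given [x], write
    [x' = sqrt (1 - x ^ 2)], [r = landen_down x = (1 - x') / (1 + x')] and
    [r' = sqrt (1 - r ^ 2)].  Then [landen_up r = x] and [landen_up x' = r'], so
    the identity used at [r] and at [x'] gives both the denominator and the
    numerator of [mu r], and the factors combine to [(1 + r) * (1 + x') = 2]
    ([mu_landen_down]).

    Landen's transformation itself is the substitution
    [x = (1 + r) * t / (1 + r * t ^ 2)], an increasing map of [[0, 1]] onto
    itself, which carries the integrand of modulus [landen_up r] to [1 + r]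
    times the integrand of modulus [r] ([landen_integrand]).  It is applied on
    [[0, b]] with [b < 1], and [b] then tends to [1]; the improper integrals
    converge because [x = 1 - y ^ 2] removes the singularity
    ([ellF_regularized]). *)

(** * Complete integrals as limits of incomplete ones *)

Definition ell_integrand (k x : R) : R :=
  / sqrt ((1 - x ^ 2) * (1 - k ^ 2 * x ^ 2)).

Definition ellF (k b : R) : R := RInt (ell_integrand k) 0 b.

Lemma ell_radicand_pos (k x : R) : open01 k -> 0 <= x < 1 ->
  0 < (1 - x ^ 2) * (1 - k ^ 2 * x ^ 2).
Proof.
intros [hk0 hk1] [hx0 hx1].
assert (h : 0 <= k * x < 1) by nra.
apply Rmult_lt_0_compat; nra.
Qed.

Lemma continuous_ell_integrand (k x : R) : open01 k -> 0 <= x < 1 ->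
  continuous (ell_integrand k) x.
Proof.
intros hk hx.
assert (h := ell_radicand_pos k x hk hx).
assert (h' := sqrt_lt_R0 _ h).
apply (@ex_derive_continuous R_AbsRing R_NormedModule).
unfold ell_integrand; auto_derive.
split.
- exact h.
- split; [apply Rgt_not_eq; exact h' | exact I].
Qed.

Lemma ex_RInt_ell_integrand (k b : R) : open01 k -> 0 <= b < 1 ->
  ex_RInt (ell_integrand k) 0 b.
Proof.
intros hk hb; apply (@ex_RInt_continuous R_CompleteNormedModule); intros z hz.
rewrite Rmin_left, Rmax_right in hz by lra.
apply continuous_ell_integrand; [exact hk | lra].
Qed.

Lemma at_left_1_pos : at_left 1 (fun b => 0 < b < 1).
Proof.
exists (mkposreal 1 Rlt_0_1); intros y hy hy1.
apply Rabs_lt_between' in hy; simpl in hy; lra.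
Qed.

(** The integrand that [ell_integrand k] becomes under [x = 1 - y ^ 2]. *)
Definition ell_reg (k y : R) : R :=
  2 / sqrt ((2 - y ^ 2) * (1 - k ^ 2 * (1 - y ^ 2) ^ 2)).

(** The bound [-1/2], rather than [0], makes [0] an interior point, as the
    continuity of [RInt (ell_reg k) y 1] at [y = 0] requires. *)
Lemma ell_reg_radicand_pos (k y : R) : open01 k -> -1/2 <= y <= 1 ->
  0 < (2 - y ^ 2) * (1 - k ^ 2 * (1 - y ^ 2) ^ 2).
Proof.
intros [hk0 hk1] hy.
assert (h1 : 0 <= y ^ 2 <= 1) by nra.
assert (h2 : 0 <= k * (1 - y ^ 2) < 1) by nra.
apply Rmult_lt_0_compat; nra.
Qed.

Lemma continuous_ell_reg (k y : R) : open01 k -> -1/2 <= y <= 1 ->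
  continuous (ell_reg k) y.
Proof.
intros hk hy.
assert (h := ell_reg_radicand_pos k y hk hy).
assert (h' := sqrt_lt_R0 _ h).
apply (@ex_derive_continuous R_AbsRing R_NormedModule).
unfold ell_reg; auto_derive.
split.
- exact h.
- split; [apply Rgt_not_eq; exact h' | exact I].
Qed.

(** With [1 - x ^ 2 = y ^ 2 * (2 - y ^ 2)], the factor [y] in the square root
    cancels against [dx = - 2 * y dy], so the new integrand is continuous up to
    [y = 0], the image of the singular endpoint. *)
Lemma ellF_regularized (k b : R) : open01 k -> 0 < b < 1 ->
  ellF k b = RInt (ell_reg k) (sqrt (1 - b)) 1.
Proof.
intros hk hb.
assert (hs2 : sqrt (1 - b) * sqrt (1 - b) = 1 - b) by (apply sqrt_sqrt; lra).
assert (hs0 : 0 < sqrt (1 - b)) by (apply sqrt_lt_R0; lra).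
set (s := sqrt (1 - b)) in *.
assert (hs1 : s < 1) by nra.
assert (E : RInt (fun y => scal (- 2 * y) (ell_integrand k (1 - y ^ 2))) s 1
            = RInt (ell_integrand k) (1 - s ^ 2) (1 - 1 ^ 2)).
{ apply (@RInt_comp R_CompleteNormedModule (ell_integrand k)
           (fun y => 1 - y ^ 2) (fun y => - 2 * y));
    intros y hy; rewrite Rmin_left, Rmax_right in hy by lra.
  - apply continuous_ell_integrand; [exact hk | nra].
  - split.
    + auto_derive; [exact I | ring].
    + apply (@ex_derive_continuous R_AbsRing R_NormedModule).
      auto_derive; exact I. }
replace (1 - s ^ 2) with b in E by (simpl; lra).
replace (1 - 1 ^ 2) with 0 in E by ring.
unfold ellF; rewrite <- (opp_RInt_swap (ell_integrand k) b 0)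
  by (apply ex_RInt_swap, ex_RInt_ell_integrand; [exact hk | lra]).
rewrite <- E, <- RInt_opp.
- apply RInt_ext; intros y hy; rewrite Rmin_left, Rmax_right in hy by lra.
  unfold ell_integrand, ell_reg, opp, scal; simpl; unfold mult; simpl.
  assert (hp := ell_reg_radicand_pos k y hk ltac:(lra)).
  replace ((1 - (1 - y * (y * 1)) * ((1 - y * (y * 1)) * 1))
           * (1 - k * (k * 1) * ((1 - y * (y * 1)) * ((1 - y * (y * 1)) * 1))))
    with (y ^ 2 * ((2 - y ^ 2) * (1 - k ^ 2 * (1 - y ^ 2) ^ 2))) by ring.
  rewrite sqrt_mult, sqrt_pow2 by nra.
  replace ((2 - y * (y * 1))
           * (1 - k * (k * 1) * ((1 - y * (y * 1)) * ((1 - y * (y * 1)) * 1))))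
    with ((2 - y ^ 2) * (1 - k ^ 2 * (1 - y ^ 2) ^ 2)) by ring.
  assert (hq := sqrt_lt_R0 _ hp).
  field; lra.
- apply (@ex_RInt_continuous R_CompleteNormedModule).
  intros y hy; rewrite Rmin_left, Rmax_right in hy by lra.
  apply (@continuous_scal R_UniformSpace R_AbsRing R_NormedModule).
  + apply (@ex_derive_continuous R_AbsRing R_NormedModule).
    auto_derive; exact I.
  + apply (@continuous_comp R_UniformSpace R_UniformSpace R_UniformSpace
             (fun y => 1 - y ^ 2) (ell_integrand k)).
    * apply (@ex_derive_continuous R_AbsRing R_NormedModule).
      auto_derive; exact I.
    * apply continuous_ell_integrand; [exact hk | nra].
Qed.

Lemma ellF_converges (k : R) : open01 k ->
  filterlim (ellF k) (at_left 1) (locally (RInt (ell_reg k) 0 1)).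
Proof.
intros hk.
assert (hex : forall a, -1/2 <= a <= 1 -> ex_RInt (ell_reg k) a 1).
{ intros a ha; apply (@ex_RInt_continuous R_CompleteNormedModule).
  intros y hy; rewrite Rmin_left, Rmax_right in hy by lra.
  apply continuous_ell_reg; [exact hk | lra]. }
apply (filterlim_ext_loc (fun b => RInt (ell_reg k) (sqrt (1 - b)) 1)).
{ generalize at_left_1_pos; apply filter_imp; intros b hb.
  symmetry; apply ellF_regularized; assumption. }
apply (filterlim_comp _ _ _ (fun b => sqrt (1 - b))
         (fun y => RInt (ell_reg k) y 1) _ (locally 0)).
- apply (filterlim_filter_le_1 (G := at_left 1) (F := locally 1)).
  { apply filter_le_within. }
  replace (locally 0) with (locally (sqrt (1 - 1)))
    by (rewrite Rminus_diag, sqrt_0; reflexivity).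
  apply (@continuous_comp R_UniformSpace R_UniformSpace R_UniformSpace
           (fun b => 1 - b) sqrt 1).
  + apply (@ex_derive_continuous R_AbsRing R_NormedModule).
    auto_derive; exact I.
  + apply continuous_sqrt.
- apply (@continuous_RInt_2 R_NormedModule (ell_reg k) 0 1
           (fun y => RInt (ell_reg k) y 1)).
  exists (mkposreal (1 / 2) ltac:(lra)); intros y hy.
  apply Rabs_lt_between' in hy; simpl in hy.
  apply (@RInt_correct R_CompleteNormedModule), hex; lra.
Qed.

Lemma K_is_limit (k : R) : open01 k ->
  filterlim (ellF k) (at_left 1) (locally (K k)).
Proof.
intros hk.
generalize (ellF_converges k hk); generalize (RInt (ell_reg k) 0 1).
intros l hlim.
assert (hgen : is_RInt_gen (ell_integrand k) (at_point 0) (at_left 1) l).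
2: { replace (K k) with l; [exact hlim|].
  symmetry; unfold K.
  exact (@is_RInt_gen_unique R_CompleteNormedModule _ _
    (Proper_StrongProper _ (at_point_filter 0))
    (Proper_StrongProper _ (at_left_proper_filter 1)) _ _ hgen). }
intros P hP.
apply Filter_prod with (Q := fun a => a = 0)
  (R := fun b => (0 < b < 1) /\ P (ellF k b)).
- reflexivity.
- apply filter_and; [apply at_left_1_pos | exact (hlim P hP)].
- intros a b -> [hb hPb]; exists (ellF k b); split; [|exact hPb].
  apply (@RInt_correct R_CompleteNormedModule).
  apply ex_RInt_ell_integrand; [exact hk | simpl; lra].
Qed.

(** * Landen's transformation *)

Definition landen_subst (r t : R) : R := (1 + r) * t / (1 + r * t ^ 2).

(** The complement of [landen_subst r t] to [1] is
    [(1 - t) * (1 - r * t) / (1 + r * t ^ 2)]. *)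
Lemma landen_subst_range (r t : R) : open01 r -> 0 <= t < 1 ->
  0 <= landen_subst r t < 1.
Proof.
intros [hr0 hr1] [ht0 ht1]; unfold landen_subst.
assert (hd : 0 < 1 + r * t ^ 2) by nra.
assert (hrt : r * t < 1) by nra.
split.
- apply Rmult_le_pos; [nra | apply Rlt_le, Rinv_0_lt_compat, hd].
- apply Rlt_div_l; [exact hd | nra].
Qed.

Lemma landen_subst_at_left (r : R) : open01 r ->
  filterlim (landen_subst r) (at_left 1) (at_left 1).
Proof.
intros hr P hP.
assert (hr' : 0 < r < 1) by exact hr.
assert (hc : continuous (landen_subst r) 1).
{ apply (@ex_derive_continuous R_AbsRing R_NormedModule).
  unfold landen_subst; auto_derive; lra. }
assert (h1 : landen_subst r 1 = 1) by (unfold landen_subst; field; lra).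
unfold continuous in hc; rewrite h1 in hc.
specialize (hc _ hP).
apply (filter_le_within (F := locally 1) (fun t => t < 1)) in hc.
change (at_left 1 (fun t => P (landen_subst r t))).
generalize (filter_and _ _ at_left_1_pos hc).
apply filter_imp; intros t [ht hPt]; apply hPt.
apply landen_subst_range; [exact hr | lra].
Qed.

Lemma landen_up_open01 (r : R) : open01 r -> open01 (landen_up r).
Proof.
intros [hr0 hr1]; unfold landen_up.
assert (hs := sqrt_lt_R0 _ hr0).
assert (hs2 := sqrt_sqrt r (Rlt_le _ _ hr0)).
set (s := sqrt r) in *.
split.
- apply Rdiv_lt_0_compat; lra.
- apply Rlt_div_l; nra.
Qed.

(** For [x = landen_subst r t] and [k = landen_up r], the two factors of the
    radicand are [1 - x ^ 2 = (1 - t ^ 2) * (1 - r ^ 2 * t ^ 2) / (1 + r * t ^ 2) ^ 2]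
    and [1 - k ^ 2 * x ^ 2 = ((1 - r * t ^ 2) / (1 + r * t ^ 2)) ^ 2]; the
    perfect square cancels against [dx / dt]. *)
Lemma landen_integrand (r t : R) : open01 r -> 0 <= t < 1 ->
  (1 + r) * (1 - r * t ^ 2) / (1 + r * t ^ 2) ^ 2
    * ell_integrand (landen_up r) (landen_subst r t)
  = (1 + r) * ell_integrand r t.
Proof.
intros hr ht.
assert (hr' : 0 < r < 1) by exact hr.
assert (hp := ell_radicand_pos r t hr ht).
assert (hq := sqrt_lt_R0 _ hp).
assert (hd : 0 < 1 + r * t ^ 2) by nra.
assert (hn : 0 < 1 - r * t ^ 2) by nra.
unfold ell_integrand.
replace ((1 - landen_subst r t ^ 2) * (1 - landen_up r ^ 2 * landen_subst r t ^ 2))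
  with (((1 - r * t ^ 2) / (1 + r * t ^ 2) ^ 2) ^ 2
        * ((1 - t ^ 2) * (1 - r ^ 2 * t ^ 2))).
- assert (hf : 0 <= (1 - r * t ^ 2) / (1 + r * t ^ 2) ^ 2)
    by (apply Rlt_le, Rdiv_lt_0_compat; nra).
  rewrite sqrt_mult by (try apply pow2_ge_0; lra).
  rewrite sqrt_pow2 by exact hf.
  field; repeat split; lra.
- replace (landen_up r ^ 2) with (4 * r / (1 + r) ^ 2).
  + unfold landen_subst; field; split; lra.
  + unfold landen_up.
    replace ((2 * sqrt r / (1 + r)) ^ 2)
      with (4 * (sqrt r * sqrt r) / (1 + r) ^ 2) by (field; lra).
    rewrite sqrt_sqrt by lra; reflexivity.
Qed.

Lemma ellF_landen (r b : R) : open01 r -> 0 < b < 1 ->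
  ellF (landen_up r) (landen_subst r b) = (1 + r) * ellF r b.
Proof.
intros hr hb.
assert (hr' : 0 < r < 1) by exact hr.
assert (hk := landen_up_open01 r hr).
unfold ellF.
replace 0 with (landen_subst r 0) at 1 by (unfold landen_subst; field).
rewrite <- (@RInt_comp R_CompleteNormedModule (ell_integrand (landen_up r))
  (landen_subst r) (fun t => (1 + r) * (1 - r * t ^ 2) / (1 + r * t ^ 2) ^ 2)).
- etransitivity.
  2: exact (@RInt_scal R_CompleteNormedModule (ell_integrand r) 0 b (1 + r)
              (ex_RInt_ell_integrand r b hr ltac:(lra))).
  apply RInt_ext; intros t ht; rewrite Rmin_left, Rmax_right in ht by lra.
  apply landen_integrand; [exact hr | lra].
- intros t ht; rewrite Rmin_left, Rmax_right in ht by lra.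
  apply continuous_ell_integrand; [exact hk|].
  apply landen_subst_range; [exact hr | lra].
- intros t ht; rewrite Rmin_left, Rmax_right in ht by lra.
  assert (hd : 0 < 1 + r * t ^ 2) by nra.
  split.
  + unfold landen_subst; auto_derive; [|field]; simpl in *; lra.
  + apply (@ex_derive_continuous R_AbsRing R_NormedModule).
    auto_derive; simpl in *; nra.
Qed.

Lemma K_landen_up (r : R) : open01 r -> K (landen_up r) = (1 + r) * K r.
Proof.
intros hr.
apply (@filterlim_locally_unique _ R_AbsRing R_NormedModule (at_left 1)
         (Proper_StrongProper _ (at_left_proper_filter 1)) (fun b => ellF (landen_up r) (landen_subst r b))).
- apply (filterlim_comp _ _ _ _ _ _ (at_left 1)).
  + apply landen_subst_at_left, hr.
  + apply K_is_limit, landen_up_open01, hr.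
- apply (filterlim_ext_loc (fun b => (1 + r) * ellF r b)).
  + generalize at_left_1_pos; apply filter_imp; intros b hb.
    symmetry; apply ellF_landen; assumption.
  + apply (filterlim_comp _ _ _ _ _ _ (locally (K r))).
    * apply K_is_limit, hr.
    * apply (@filterlim_scal_r R_AbsRing R_NormedModule).
Qed.

(** * The descending Landen map doubles mu *)

Lemma conj_modulus_open01 (x : R) : open01 x -> open01 (sqrt (1 - x ^ 2)).
Proof.
intros [hx0 hx1]; split.
- apply sqrt_lt_R0; nra.
- rewrite <- sqrt_1 at 2; apply sqrt_lt_1; nra.
Qed.

Lemma landen_down_conj (x : R) : open01 x ->
  landen_down x = (1 - sqrt (1 - x ^ 2)) / (1 + sqrt (1 - x ^ 2)).
Proof.
intros hx; assert (hy := conj_modulus_open01 x hx).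
destruct hx as [hx0 hx1].
assert (hy2 : sqrt (1 - x ^ 2) * sqrt (1 - x ^ 2) = 1 - x ^ 2)
  by (apply sqrt_sqrt; nra).
unfold landen_down.
set (y := sqrt (1 - x ^ 2)) in *; destruct hy as [hy0 hy1].
replace ((x / (1 + y)) ^ 2) with (x ^ 2 / (1 + y) ^ 2) by (field; lra).
replace (x ^ 2) with ((1 - y) * (1 + y)) by lra.
field; lra.
Qed.

Lemma landen_down_open01 (x : R) : open01 x -> open01 (landen_down x).
Proof.
intros hx; rewrite landen_down_conj by exact hx.
destruct (conj_modulus_open01 x hx) as [hy0 hy1].
split.
- apply Rdiv_lt_0_compat; lra.
- apply Rlt_div_l; lra.
Qed.

Lemma landen_up_down (x : R) : open01 x -> landen_up (landen_down x) = x.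
Proof.
intros hx.
assert (hd := landen_down_conj x hx).
destruct (conj_modulus_open01 x hx) as [hy0 hy1].
unfold landen_up; rewrite hd at 2; unfold landen_down.
destruct hx as [hx0 hx1].
rewrite sqrt_pow2.
- field; lra.
- apply Rlt_le, Rdiv_lt_0_compat; lra.
Qed.

Lemma conj_landen_down (x : R) : open01 x ->
  sqrt (1 - landen_down x ^ 2) = landen_up (sqrt (1 - x ^ 2)).
Proof.
intros hx; rewrite landen_down_conj by exact hx.
destruct (conj_modulus_open01 x hx) as [hy0 hy1].
set (y := sqrt (1 - x ^ 2)) in *.
assert (hs := sqrt_pos y); assert (hs2 := sqrt_sqrt y (Rlt_le _ _ hy0)).
unfold landen_up.
replace (1 - ((1 - y) / (1 + y)) ^ 2) with ((2 * sqrt y / (1 + y)) ^ 2).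
- apply sqrt_pow2, Rdiv_le_0_compat; lra.
- replace ((2 * sqrt y / (1 + y)) ^ 2)
    with (4 * (sqrt y * sqrt y) / (1 + y) ^ 2) by (field; lra).
  rewrite hs2; field; lra.
Qed.

Lemma mu_landen_down (x : R) : open01 x -> mu (landen_down x) = 2 * mu x.
Proof.
intros hx.
assert (hnum := K_landen_up _ (conj_modulus_open01 x hx)).
rewrite <- conj_landen_down in hnum by exact hx.
assert (hden := K_landen_up _ (landen_down_open01 x hx)).
rewrite landen_up_down in hden by exact hx.
assert (hd := landen_down_conj x hx).
destruct (conj_modulus_open01 x hx) as [hy0 hy1].
assert (h2 : / (1 + landen_down x) = (1 + sqrt (1 - x ^ 2)) / 2)
  by (rewrite hd; field; lra).
unfold mu; rewrite hnum, hden.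
unfold Rdiv; rewrite Rinv_mult, h2.
(* Both sides are linear in [/ K (landen_down x)], so it can be any real. *)
generalize (/ K (landen_down x)); intros c; field.
Qed.

Lemma landen_down_iter (r : R) (n : nat) : open01 r ->
  open01 (Nat.iter n landen_down r) /\
  mu (Nat.iter n landen_down r) = 2 ^ n * mu r.
Proof.
intros hr; induction n as [|n [IHo IHm]]; simpl.
- split; [exact hr | ring].
- split.
  + apply landen_down_open01, IHo.
  + rewrite mu_landen_down, IHm by exact IHo; ring.
Qed.

Lemma L_opp_nat (r : R) (n : nat) :
  L r (- Z.of_nat n) = Nat.iter n landen_down r.
Proof.
destruct n as [|n]; [reflexivity|].
cbn [Z.of_nat Z.opp L]; rewrite SuccNat2Pos.id_succ; reflexivity.
Qed.

(** * Limits along the descending sequence *)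

Lemma landen_limit (w : R -> R) (M r : R) :
  (forall x, open01 x -> Rabs (w x - mu x) < M) -> open01 r ->
  filterlim (fun p : Z => powerRZ 2 p * w (L r p)) Z_minus_infty (locally (mu r)).
Proof.
intros hw hr.
assert (hM : 0 < M)
  by (apply (Rle_lt_trans _ _ _ (Rabs_pos (w r - mu r))), hw, hr).
apply filterlim_locally; intros eps.
destruct (pow_lt_1_zero (/ 2) ltac:(rewrite Rabs_pos_eq; lra) (eps / M)
            (Rdiv_lt_0_compat _ _ (cond_pos eps) hM)) as [N hN].
exists (- Z.of_nat N)%Z; intros p hp.
pose (n := Z.to_nat (- p)).
replace p with (- Z.of_nat n)%Z by (unfold n; lia).
specialize (hN n ltac:(unfold n; lia)).
rewrite L_opp_nat, powerRZ_neg', <- pow_powerRZ, <- pow_inv.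
destruct (landen_down_iter r n hr) as [ho hm].
specialize (hw _ ho); rewrite hm in hw.
set (W := w (Nat.iter n landen_down r)) in *.
assert (hpos : 0 < (/ 2) ^ n) by (apply pow_lt; lra).
rewrite Rabs_pos_eq in hN by lra.
apply Rlt_div_r in hN; [|exact hM].
change (Rabs ((/ 2) ^ n * W - mu r) < eps).
replace ((/ 2) ^ n * W - mu r) with ((/ 2) ^ n * (W - 2 ^ n * mu r)).
- rewrite Rabs_mult, (Rabs_pos_eq ((/ 2) ^ n)) by lra; nra.
- assert (h2 : 2 ^ n <> 0) by (apply pow_nonzero; lra).
  rewrite pow_inv; field; exact h2.
Qed.

Theorem proposition3p2 (u v : R -> R) (M : R)
  (hu_pos : forall r : R, open01 r -> 0 < u r)
  (hv_pos : forall r : R, open01 r -> 0 < v r)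
  (hu_cont : continuous_on open01 u)
  (hv_cont : continuous_on open01 v)
  (hM : forall r : R, open01 r -> Rabs (u r - v r) < M)
  (hmu : forall r : R, open01 r -> u r < mu r < v r) :
  forall r : R, open01 r ->
    filterlim (fun p : Z => powerRZ 2 p * u (L r p)) Z_minus_infty (locally (mu r)) /\
    filterlim (fun p : Z => powerRZ 2 p * v (L r p)) Z_minus_infty (locally (mu r)).
Proof.
intros r hr; split; apply (landen_limit _ M); try exact hr;
  intros x hx; specialize (hM x hx); specialize (hmu x hx);
  apply Rabs_def2 in hM; apply Rabs_def1; lra.
Qed.
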